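(* For each $n$ there exists a nonzero polynomial $f_n\in\mathbb C[x_{ij}\mid i\le j\le n]$ such that any two matrices $A,B\in M_n(f_n)$ whose main diagonals are lexicographically ordered are unitarily similar if and only if $$\|h(A_k)\|=\|h(B_k)\|\qquad\text{for all } h\in\mathbb C[x]\text{ and } k=1,\dots,n,$$ where $A_k$ and $B_k$ are the principal $k\times k$ submatrices of $A$ and $B$. (That is, two $n\times n$ upper triangular matrices $A$ and $B$ in general position with lexicographically ordered eigenvalues on the main diagonal are unitarily similar if and only if the displayed condition holds.)
   Context: All matrices are complex. Square matrices $A,B$ of the same size are unitarily similar if $U^{-1}AU=B$ for some unitary matrix $U$. The principal $k\times k$ submatrix $M_k$ of a matrix $M$ is the submatrix at the intersection of its first $k$ rows and first $k$ columns. $\|M\|=\sqrt{\sum_{i,j}|m_{ij}|^2}$ is the Frobenius norm. $\mathbb C[x_{ij}\mid i\le j\le n]$ is the polynomial ring in the variables $x_{ij}$, $1\le i\le j\le n$. For a polynomial $f$ in it and an upper triangular matrix $A=[a_{ij}]\in\mathbb C^{n\times n}$, $f\{A\}$ denotes the value of $f$ at $x_{ij}=a_{ij}$ ($i\le j$), and $$M_n(f):=\{A\in\mathbb C^{n\times n}\mid A\text{ is upper triangular and } f\{A\}\ne 0\}.$$ Upper triangular $n\times n$ matrices ''in general position'' possess a property if there is a nonzero polynomial $f_n\in\mathbb C[x_{ij}\mid i\le j\le n]$ such that all matrices in $M_n(f_n)$ possess it. Lexicographical order on $\mathbb C$: for real $a,b,c,d$, $a+bi\preccurlyeq c+di$ if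 either $a<c$, or $a=c$ and $b\le d$. The main diagonal $(\lambda_1,\dots,\lambda_n)$ of a matrix is lexicographically ordered if $\lambda_1\preccurlyeq\dots\preccurlyeq\lambda_n$. *)

(* Defs.v *)
From HB Require Import structures.
From mathcomp Require Import all_boot all_order all_algebra.
From mathcomp Require Import spectral complex mpoly reals.

Set Implicit Arguments.
Unset Strict Implicit.
Unset Printing Implicit Defensive.

Import Order.TTheory GRing.Theory Num.Theory.
Local Open Scope ring_scope.
Local Open Scope complex_scope.

Definition triu n : {set 'I_n * 'I_n} :=
  [set p : 'I_n * 'I_n | (p.1 <= p.2)%N].

(* The variable x_ij is 'X_v for the rank v of (i, j) in the enumeration of
   [triu n]. *)
Definition triu_poly (R : realType) n := {mpoly R[i][#|triu n|]}.

Definition triu_eval (R : realType) n (f : triu_poly R n) (A : 'M[R[i]]_n) :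
    R[i] :=
  f.@[fun v => A (enum_val v).1 (enum_val v).2].

(* [is_trig_mx] means lower triangular, hence the transpose. *)
Definition upper_triangular (R : realType) n (A : 'M[R[i]]_n) : bool :=
  is_trig_mx A^T.

Definition in_Mn (R : realType) n (f : triu_poly R n) (A : 'M[R[i]]_n) : Prop :=
  upper_triangular A /\ triu_eval f A != 0.

(* The canonical order on R[i] is a partial one, comparing only numbers
   with equal imaginary parts. *)
Definition lexle (R : realType) (z w : R[i]) : Prop :=
  complex.Re z < complex.Re w \/
  complex.Re z = complex.Re w /\ complex.Im z <= complex.Im w.

Definition lex_ordered_diag (R : realType) n (A : 'M[R[i]]_n) : Prop :=
  forall i j : 'I_n, (i <= j)%N -> lexle (A i i) (A j j).

Definition unitarily_similar (R : realType) n (A B : 'M[R[i]]_n) : Prop :=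
  exists2 U : 'M[R[i]]_n, U \is unitarymx & invmx U *m A *m U = B.

Definition frobenius (R : realType) m n (M : 'M[R[i]]_(m, n)) : R[i] :=
  sqrtC (\sum_i \sum_j `|M i j| ^+ 2).

(* The principal submatrix of size k + 1, for k = 0, ..., n - 1. *)
Definition principal (R : realType) n (A : 'M[R[i]]_n) (k : 'I_n) :
    'M[R[i]]_k.+1 :=
  mxsub (widen_ord (ltn_ord k)) (widen_ord (ltn_ord k)) A.

(* Main.v *)
Require Import Defs.
From mathcomp Require Import all_boot all_order all_algebra.
From mathcomp Require Import spectral complex mpoly reals ring.

Set Implicit Arguments.
Unset Strict Implicit.
Unset Printing Implicit Defensive.

Import Order.TTheory GRing.Theory Num.Theory.
Local Open Scope ring_scope.

(** For an upper triangular [A], number rows and columns from [0] and let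
    [L_j] be the product of the ['X - A i i] over [i != j].  The first rows of
    the matrices [L_j(A)] are left eigenvectors of [A]; stacked, they form a
    matrix [Y(A)] with [Y(A) *m A = D *m Y(A)], where [D] is the diagonal part
    of [A].  Genericity asks that [Y(A)] be invertible and that its row 0 have
    no zero entry.  Both conditions are polynomial in the entries of [A]
    ([generic]), they hold for some [A] ([generic_witness]), and the first one
    forces the eigenvalues to be distinct ([eigenrows_diag_inj]).

    If all the norms agree, then [A] and [B] have the same diagonal:
    Cayley-Hamilton makes the characteristic polynomial of [A_k] annihilate
    [B_k], and the eigenvalues are peeled off one index at a time
    ([same_norms_diag]).  Since [h(A_k)] is the principal submatrix of [h(A)],
    comparing the norms for [k] and [k - 1] gives the norm of column [k] of
    [h(A)], hence, by polarization, the scalar product of column [k] of [g(A)]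
    with column [k] of [h(A)] ([same_norms_columns]).  For [g = L_j] and
    [h = L_0] this product has a single term, because only row 0 of [L_0(A)]
    is nonzero ([lagrange_num0_row]): so [A] and [B] share the numbers
    [Y_jk * (Y_0k)^*].  Therefore [Y(B) = Y(A) *m U], where the diagonal matrix
    [U] of the quotients [Y(B)_0k / Y(A)_0k] is unitary; and as [Y(A)] and
    [Y(B)] diagonalize [A] and [B] to the same [D], [U] conjugates [A] into
    [B].  The scalar products of eigenvectors are not algebraic in the entries
    of [A]; using only those with column multiples of the first basis vector is
    what keeps the genericity conditions free of complex conjugates.

    Conversely, a unitary similarity preserves the spectrum, hence the diagonal
    once it is lexicographically ordered ([similar_diag]).  A matrix that
    intertwines triangular matrices with the same simple diagonal is triangular
    ([intertwiner_eq0]); applied to [U] and to its inverse, which is its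
    conjugate transpose, this makes [U] diagonal, so that [h(A)] and [h(B)]
    have entries of equal moduli. *)

(** * Triangular matrices and their intertwiners *)

(** At a position [(i, j)] of [P], the products [A *m U] and [U *m B] involve,
    besides [U i j], only entries of [U] lower in column [j] or further left in
    row [i]; these again lie in [P], so that [(A i i - B j j) * U i j = 0] by
    induction from the bottom left corner. *)
Lemma intertwiner_eq0 (F : fieldType) n (P : rel 'I_n) (A B U : 'M[F]_n) :
    is_trig_mx A^T -> is_trig_mx B^T -> A *m U = U *m B ->
    (forall i j k : 'I_n, P i j -> (i < k)%N -> P k j) ->
    (forall i j k : 'I_n, P i j -> (k < j)%N -> P i k) ->
    (forall i j, P i j -> A i i != B j j) ->
  forall i j, P i j -> U i j = 0.
Proof.
move=> /is_trig_mxP tA /is_trig_mxP tB AU Pd Pl PAB i j.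
have [m] := ubnP (n - i + j); elim: m i j => // m IHm i j lt_m Pij.
have {AU} : (A *m U) i j = (U *m B) i j by rewrite AU.
have lt_in := ltn_ord i.
have termA k : k != i -> A i k * U k j = 0.
  case: (ltngtP i k) => [lt_ik _|lt_ki _|/val_inj ->]; last by rewrite eqxx.
  - rewrite (IHm k j) ?mulr0 //; last exact: Pd Pij lt_ik.
    rewrite -ltnS; apply: leq_trans lt_m.
    by rewrite ltnS -addSn leq_add2r ltn_sub2l.
  - by move: (tA _ _ lt_ki); rewrite mxE => ->; rewrite mul0r.
have termB k : k != j -> U i k * B k j = 0.
  case: (ltngtP k j) => [lt_kj _|lt_jk _|/val_inj ->]; last by rewrite eqxx.
  - rewrite (IHm i k) ?mul0r //; last exact: Pl Pij lt_kj.
    by rewrite -ltnS; apply: leq_trans lt_m; rewrite ltnS -addnS leq_add2l.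
  - by move: (tB _ _ lt_jk); rewrite mxE => ->; rewrite mulr0.
rewrite !mxE (bigD1 i) //= [X in _ + X]big1 // addr0.
rewrite (bigD1 j) //= [X in _ = _ + X]big1 // addr0 => /eqP.
rewrite [U i j * _]mulrC -subr_eq0 -mulrBl mulf_eq0 subr_eq0 (negPf (PAB _ _ Pij)).
by move/eqP.
Qed.

Lemma char_poly_triu (R : comNzRingType) n (A : 'M[R]_n) :
  is_trig_mx A^T -> char_poly A = \prod_i ('X - (A i i)%:P).
Proof.
move=> /char_poly_trig; under [RHS]eq_bigr do rewrite mxE.
move=> <-; rewrite /char_poly -det_tr; congr (\det _).
by apply/matrixP => i j; rewrite !mxE eq_sym.
Qed.

(** * Principal submatrices of polynomials in a triangular matrix *)

Section Principal.
Variables (R : realType) (n : nat).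
Implicit Types (A : 'M[R[i]]_n.+1) (k : 'I_n.+1) (h : {poly R[i]}).

Lemma upper_triangularP A :
  upper_triangular A -> forall i j : 'I_n.+1, (j < i)%N -> A i j = 0.
Proof. by move=> /is_trig_mxP tA i j /tA; rewrite mxE. Qed.

Lemma principal_mul A (C : 'M[R[i]]_n.+1) k :
  upper_triangular A -> principal (C *m A) k = principal C k *m principal A k.
Proof.
move=> tA; apply/matrixP => i j; rewrite !mxE.
rewrite (bigID (fun l : 'I_n.+1 => l < k.+1)%N) /= [X in _ + X]big1 ?addr0.
  rewrite (big_ord_narrow (ltn_ord k)).
  by apply: eq_bigr => l _; rewrite !mxE.
move=> l; rewrite -leqNgt => lt_kl; rewrite (upper_triangularP tA) ?mulr0 //=.
exact: leq_ltn_trans (leq_ord j) lt_kl.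
Qed.

(** Truncation to the leading block is a ring morphism on upper triangular
    matrices. *)
Lemma principal_horner A k h : upper_triangular A ->
  principal (horner_mx A h) k = horner_mx (principal A k) h.
Proof.
move=> tA; elim/poly_ind: h => [|h c IHh].
  by rewrite !rmorph0; apply/matrixP => i j; rewrite !mxE.
rewrite !rmorphD !rmorphM /= !horner_mx_X !horner_mx_C -IHh.
rewrite -[_ * principal A k]/(_ *m _) -principal_mul //.
by apply/matrixP => i j; rewrite !mxE.
Qed.

Lemma principal_triu A k : upper_triangular A -> upper_triangular (principal A k).
Proof.
by move=> tA; apply/is_trig_mxP => i j lt_ij; rewrite !mxE (upper_triangularP tA).
Qed.

Lemma horner_triu A h : upper_triangular A -> upper_triangular (horner_mx A h).
Proof.
move=> tA; elim/poly_ind: h => [|h c tM].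
  by rewrite rmorph0; apply/is_trig_mxP => i j _; rewrite !mxE.
rewrite rmorphD rmorphM /= horner_mx_X horner_mx_C.
apply/is_trig_mxP => i j lt_ij; rewrite !mxE -(inj_eq val_inj).
rewrite gtn_eqF // addr0 big1 // => l _.
have [lt_lj|le_jl] := ltnP l j; first by rewrite (upper_triangularP tM) ?mul0r.
by rewrite (upper_triangularP tA) ?mulr0 // (leq_trans lt_ij).
Qed.

(** The partial sums over columns let the norms for consecutive [k] isolate a
    single column of [h(A)]. *)
Lemma frobenius_principal A k h : upper_triangular A ->
  frobenius (horner_mx (principal A k) h) ^+ 2 =
  \sum_(j : 'I_n.+1 | (j <= k)%N) \sum_i `|horner_mx A h i j| ^+ 2.
Proof.
move=> tA; rewrite /frobenius sqrtCK exchange_big /= -principal_horner //.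
under [RHS]eq_bigl do rewrite -ltnS; rewrite (big_ord_narrow (ltn_ord k)).
apply: eq_bigr => j _.
rewrite [RHS](bigID (fun i : 'I_n.+1 => i < k.+1)%N) /=.
rewrite [X in _ = _ + X]big1 ?addr0 => [|i].
  by rewrite (big_ord_narrow (ltn_ord k)); apply: eq_bigr => i _; rewrite mxE.
rewrite -leqNgt => lt_ki; rewrite (upper_triangularP (horner_triu h tA)).
  by rewrite normr0 expr0n.
exact: leq_ltn_trans (leq_ord j) lt_ki.
Qed.
End Principal.

(** * The stacked left eigenvectors and the genericity polynomial *)

(** The numerator of the Lagrange interpolation polynomial at [d j], kept
    without its denominator so that evaluations at a matrix are polynomial in
    the entries. *)
Definition lagrange_num (K : comNzRingType) n (d : 'I_n -> K) (j : 'I_n) :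
    {poly K} :=
  \prod_(i | i != j) ('X - (d i)%:P).

(** Defined over any commutative ring, in order to apply to the matrix of
    indeterminates as well as to its specializations. *)
Definition eigenrows (K : comNzRingType) n (A : 'M[K]_n.+1) : 'M[K]_n.+1 :=
  \matrix_(j, k) horner_mx A (lagrange_num (fun i => A i i) j) 0 k.

Definition generic (K : comNzRingType) n (A : 'M[K]_n.+1) : K :=
  \det (eigenrows A) * \prod_k eigenrows A 0 k.

Lemma map_eigenrows (K L : comNzRingType) (f : {rmorphism K -> L}) n
    (A : 'M[K]_n.+1) : eigenrows (map_mx f A) = map_mx f (eigenrows A).
Proof.
apply/matrixP => j k; rewrite !mxE.
have /matrixP/(_ 0 k) := map_horner_mx f A (lagrange_num (fun i => A i i) j).
rewrite mxE => ->; congr (horner_mx _ _ _ _); rewrite /lagrange_num rmorph_prod.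
by apply: eq_bigr => i _; rewrite /= map_polyXsubC mxE.
Qed.

Lemma map_generic (K L : comNzRingType) (f : {rmorphism K -> L}) n
    (A : 'M[K]_n.+1) : generic (map_mx f A) = f (generic A).
Proof.
rewrite /generic map_eigenrows det_map_mx rmorphM rmorph_prod.
by congr (_ * _); apply: eq_bigr => k _; rewrite mxE.
Qed.

Lemma char_poly_lagrange_num (K : comNzRingType) n (A : 'M[K]_n) j :
  is_trig_mx A^T ->
  char_poly A = lagrange_num (fun i => A i i) j * ('X - (A j j)%:P).
Proof. by move=> /char_poly_triu ->; rewrite (bigD1 j) // mulrC. Qed.

Lemma lagrange_num_mul (K : comNzRingType) n (A : 'M[K]_n.+1) j :
    is_trig_mx A^T ->
  horner_mx A (lagrange_num (fun i => A i i) j) *m A =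
  A j j *: horner_mx A (lagrange_num (fun i => A i i) j).
Proof.
move=> /(char_poly_lagrange_num j)/(congr1 (horner_mx A)).
rewrite Cayley_Hamilton rmorphM /= rmorphB /= horner_mx_X horner_mx_C.
move=> /esym/eqP; rewrite mulrBr subr_eq0 => /eqP LA.
by rewrite -mul_mx_scalar; exact: LA.
Qed.

Lemma eigenrows_mul (K : comNzRingType) n (A : 'M[K]_n.+1) : is_trig_mx A^T ->
  eigenrows A *m A = diag_mx (\row_i A i i) *m eigenrows A.
Proof.
move=> tA; apply/matrixP => j k; rewrite mul_diag_mx !mxE.
have /matrixP/(_ 0 k) := lagrange_num_mul j tA; rewrite !mxE => <-.
by apply: eq_bigr => i _; rewrite mxE.
Qed.

(** Equal diagonal entries would give [eigenrows A] two equal rows. *)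
Lemma eigenrows_diag_inj (K : comNzRingType) n (A : 'M[K]_n.+1) :
  \det (eigenrows A) != 0 -> injective (fun i => A i i).
Proof.
move=> det_neq0 i j eq_ij; apply/eqP; apply: contraNT det_neq0 => ne_ij.
apply/eqP/(determinant_alternate ne_ij) => k; rewrite !mxE /lagrange_num.
congr (horner_mx A _ 0 k); transitivity (\prod_(l | l != i) ('X - (A l l)%:P)) => //.
rewrite (bigD1 j) 1?eq_sym //= [RHS](bigD1 i) //= eq_ij; congr (_ * _).
by apply: eq_bigl => l; rewrite andbC.
Qed.

Lemma genericP (K : idomainType) n (A : 'M[K]_n.+1) : generic A != 0 ->
  \det (eigenrows A) != 0 /\ forall k, eigenrows A 0 k != 0.
Proof.
rewrite /generic mulf_eq0 negb_or => /andP[detA Y0]; split=> [|k]; first exact: detA.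
by apply: contraNneq Y0 => Y0k; apply/prodf_eq0; exists k; rewrite ?Y0k.
Qed.

(** The columns are right eigenvectors for [A 0 0], an eigenspace spanned by the
    first basis vector. *)
Lemma lagrange_num0_row (F : fieldType) n (A : 'M[F]_n.+1) :
    is_trig_mx A^T -> injective (fun i => A i i) ->
  forall i k : 'I_n.+1, i != 0 ->
    horner_mx A (lagrange_num (fun i => A i i) 0) i k = 0.
Proof.
move=> tA injA i k; pose P := [rel i _ : 'I_n.+1 | i != 0].
apply: (@intertwiner_eq0 _ _ P A (A 0 0)%:M).
- by [].
- by rewrite tr_scalar_mx scalar_mx_is_trig.
- rewrite mul_mx_scalar -lagrange_num_mul //.
  exact: (comm_mx_horner _ (comm_mx_refl A)).
- move=> i' j k' _ /=; rewrite -!(inj_eq val_inj) /=.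
  by case: (val k').
- by [].
- by move=> i' j /=; rewrite mxE eqxx; apply: contraNneq => /injA ->.
Qed.

(** Prescribe the eigenvectors: [A = S D S^-1] for [D] diagonal with simple
    spectrum and [S = 1 + N], where [N] has ones in row 0 off the diagonal.  As
    row 0 of [S] is constant, [eigenrows A] is the inverse [1 - N] of [S] up to
    nonzero row factors. *)
Lemma generic_witness (F : numFieldType) n :
  exists2 A : 'M[F]_n.+1, is_trig_mx A^T & generic A != 0.
Proof.
pose N : 'M[F]_n.+1 := \matrix_(i, j) ((i == 0) && (j != 0))%:R.
pose d : 'rV[F]_n.+1 := \row_j (val j)%:R.
have NN : N *m N = 0.
  apply/matrixP => i j; rewrite !mxE big1 // => k _; rewrite !mxE.
  by case: (k == 0); rewrite ?andbF ?mul0r ?mulr0.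
pose S := 1%:M + N; pose T := 1%:M - N.
have ST : S *m T = 1%:M.
  by rewrite mulmxBr mulmx1 mulmxDl mul1mx NN addr0 addrK.
have [S_unit _] := mulmx1_unit ST.
have invS : invmx S = T by rewrite -[RHS]mul1mx -(mulVmx S_unit) -mulmxA ST mulmx1.
pose A := diag_mx d + N *m diag_mx d.
(* The eigenvalue at index 0 is 0, so [diag_mx d] kills row 0. *)
have DN : diag_mx d *m N = 0.
  apply/matrixP => i j; rewrite mul_diag_mx !mxE.
  by case: eqP => [->|_]; rewrite ?mul0r ?mulr0.
have defA : A = S *m diag_mx d *m invmx S.
  rewrite invS /A mulmxDl mul1mx mulmxBr mulmx1 mulmxDl -mulmxA DN mulmx0.
  by rewrite addr0 subr0.
have diagA i : A i i = d 0 i.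
  by rewrite /A mul_mx_diag !mxE eqxx mulr1n andbN mul0r addr0.
pose c j := (lagrange_num (d 0) j).[d 0 j].
have d_inj i j : (d 0 i == d 0 j) = (i == j).
  by rewrite !mxE eqr_nat.
have c_neq0 j : c j != 0.
  rewrite /c horner_prod prodf_seq_neq0; apply/allP => i _; apply/implyP => ne_ij.
  by rewrite hornerXsubC subr_eq0 d_inj eq_sym.
have S0 j : S 0 j = 1.
  by rewrite !mxE eqxx eq_sym; case: (j == 0); rewrite ?addr0 ?add0r.
have YA : eigenrows A = diag_mx (\row_j c j) *m T.
  apply/matrixP => j k; rewrite mul_diag_mx !mxE.
  have -> : lagrange_num (fun i => A i i) j = lagrange_num (d 0) j.
    by apply: eq_bigr => i _; rewrite diagA.
  rewrite defA horner_mx_uconj // invS horner_mx_diag !mxE (bigD1 j) //=.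
  rewrite mul_mx_diag big1 ?addr0.
    by rewrite mxE S0 mul1r /c !mxE.
  move=> i ne_ij; rewrite 2!mxE [X in _ * X * _]mxE /lagrange_num horner_prod.
  by rewrite (bigD1 i) //= hornerXsubC subrr !(mul0r, mulr0).
exists A.
  apply/is_trig_mxP => i j lt_ij; rewrite mxE /A mul_mx_diag !mxE.
  have ne_ji : (j == i) = false by rewrite -(inj_eq val_inj) gtn_eqF.
  have -> : (j == 0) = false.
    by rewrite -(inj_eq val_inj) gtn_eqF // (leq_ltn_trans _ lt_ij).
  by rewrite ne_ji mulr0n mul0r addr0.
rewrite /generic YA mulf_neq0 //.
  have /(congr1 determinant) := ST; rewrite !det_mulmx det1 det_diag => ST1.
  rewrite mulf_neq0 //; last first.
    by apply: contra_eq_neq ST1 => ->; rewrite mulr0 eq_sym oner_eq0.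
  by rewrite prodf_seq_neq0; apply/allP => i _; rewrite mxE c_neq0.
rewrite prodf_seq_neq0; apply/allP => k _ /=.
rewrite mul_diag_mx 2!mxE mulf_neq0 //; rewrite !mxE eqxx [0 == k]eq_sym.
by case: (k == 0); rewrite /= ?subr0 ?add0r ?oppr_eq0 oner_eq0.
Qed.

(** * Equality of the norms implies unitary similarity *)

Lemma polarC (C : numClosedFieldType) (x y : C) :
  4 * (x * y^*) = `|x + y| ^+ 2 - `|x - y| ^+ 2
    + 'i * (`|x + 'i * y| ^+ 2 - `|x - 'i * y| ^+ 2).
Proof.
rewrite !normCK !rmorphD !rmorphN !rmorphM /= !conjCi.
set x' := x^*; set y' := y^*.
transitivity (2 * (x * y' + y * x') + 2 * ('i ^+ 2) * (y * x' - x * y')).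
  by rewrite sqrCi; ring.
by ring.
Qed.

Lemma polarization (C : numClosedFieldType) n (x y x' y' : 'I_n -> C) :
    (forall c, \sum_i `|x i + c * y i| ^+ 2 = \sum_i `|x' i + c * y' i| ^+ 2) ->
  \sum_i x i * (y i)^* = \sum_i x' i * (y' i)^*.
Proof.
have polar z w : 4 * (\sum_i z i * (w i)^*) =
    \sum_i `|z i + 1 * w i| ^+ 2 - \sum_i `|z i + (- 1) * w i| ^+ 2
  + 'i * (\sum_i `|z i + 'i * w i| ^+ 2 - \sum_i `|z i + (- 'i) * w i| ^+ 2) :> C.
  move=> {x y x' y'}; rewrite mulr_sumr -!sumrB mulr_sumr -big_split /=.
  by apply: eq_bigr => i _; rewrite polarC mul1r mulN1r mulNr.
move=> eq_norm; apply: (@mulfI _ 4); first by rewrite pnatr_eq0.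
by rewrite !polar !eq_norm.
Qed.

Lemma eq_partial_sums (V : zmodType) n (F G : 'I_n -> V) :
    (forall k : 'I_n,
       \sum_(j < n | (j <= k)%N) F j = \sum_(j < n | (j <= k)%N) G j) ->
  F =1 G.
Proof.
move=> eqFG k; have [m] := ubnP k; elim: m k => // m IHm k; rewrite ltnS => le_km.
have := eqFG k; rewrite (bigD1 k) //= [RHS](bigD1 k) //= => eq_k.
apply: addIr (etrans eq_k _); congr (_ + _); apply: eq_bigr => j /andP[le_jk ne_jk].
by apply/esym/IHm; rewrite (leq_trans _ le_km) // ltn_neqAle le_jk andbT.
Qed.

Section NormsToSimilarity.
Variables (R : realType) (n : nat).
Local Notation C := R[i].
Implicit Types (A B : 'M[C]_n.+1) (k : 'I_n.+1) (h : {poly C}).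

Definition same_norms A B := forall h k,
  frobenius (horner_mx (principal A k) h) = frobenius (horner_mx (principal B k) h).

Lemma frobenius_eq0 m (M : 'M[C]_m) : frobenius M = 0 -> M = 0.
Proof.
move/eqP; rewrite sqrtC_eq0 => /eqP/psumr_eq0P M0.
apply/matrixP => i j; rewrite mxE.
have /psumr_eq0P/(_ j isT)/eqP : \sum_j `|M i j| ^+ 2 = 0.
  by apply: M0 => // i' _; apply: sumr_ge0 => j' _; rewrite exprn_ge0.
rewrite sqrf_eq0 normr_eq0 => M0'; apply/eqP; apply: M0' => j' _.
by rewrite exprn_ge0.
Qed.

(** By Cayley-Hamilton [B k k] is one of the [A i i] with [i <= k]; by induction
    [A i i = B i i] for [i < k], which leaves only [i = k]. *)
Lemma same_norms_diag A B : upper_triangular A -> upper_triangular B ->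
  injective (fun i => B i i) -> same_norms A B -> forall k, A k k = B k k.
Proof.
move=> tA tB injB eqAB k; have [m] := ubnP k; elim: m k => // m IHm k.
rewrite ltnS => le_km.
pose kk : 'I_k.+1 := ord_max.
have wk : widen_ord (ltn_ord k) kk = k by apply: val_inj.
set Ak := principal A k; set Bk := principal B k.
have chiA : horner_mx Bk (char_poly Ak) = 0.
  apply: frobenius_eq0; rewrite -eqAB Cayley_Hamilton /frobenius.
  rewrite big1 ?sqrtC0 // => i _; rewrite big1 // => j _.
  by rewrite mxE normr0 expr0n.
have : root (mxminpoly Bk) (B k k).
  rewrite -eigenvalue_root_min eigenvalue_root_char.
  rewrite (char_poly_triu (principal_triu k tB)) /root horner_prod.
  by apply/prodf_eq0; exists kk; rewrite // hornerXsubC mxE wk subrr.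
move/(root_dvdp (mxminpoly_min chiA)).
rewrite (char_poly_triu (principal_triu k tA)) /root horner_prod.
case/prodf_eq0 => i _; rewrite hornerXsubC mxE subr_eq0.
set i' := widen_ord _ i => /eqP eqBA.
have [eq_i'k|ne_i'k] := eqVneq i' k; first by rewrite eqBA eq_i'k.
have lt_i'k : (i' < k)%N by rewrite ltn_neqAle ne_i'k /= -ltnS ltn_ord.
move: eqBA; rewrite IHm ?(leq_trans lt_i'k) // => /injB eq_k.
by rewrite eq_k eqxx in ne_i'k.
Qed.

Lemma same_norms_columns A B : upper_triangular A -> upper_triangular B ->
    same_norms A B -> forall g h k,
  \sum_i horner_mx A g i k * (horner_mx A h i k)^*
    = \sum_i horner_mx B g i k * (horner_mx B h i k)^*.
Proof.
move=> tA tB eqAB g h k; apply: polarization => c.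
pose F A j := \sum_i `|horner_mx A (g + c *: h) i j| ^+ 2.
suff: F A =1 F B.
  have FE M : F M k = \sum_i `|horner_mx M g i k + c * horner_mx M h i k| ^+ 2.
    by apply: eq_bigr => i _; rewrite rmorphD /= horner_mxZ !mxE.
  by move/(_ k); rewrite !FE.
by apply: eq_partial_sums => l; rewrite -!frobenius_principal // eqAB.
Qed.

(** The Gram data [eqY] determine each column of [eigenrows] up to one phase
    [u k], and the phases form the conjugating matrix. *)
Lemma same_norms_similar A B : upper_triangular A -> upper_triangular B ->
  generic A != 0 -> generic B != 0 -> same_norms A B -> unitarily_similar A B.
Proof.
move=> tA tB /genericP[detA Y0A] /genericP[detB Y0B] eqAB.
have injA := eigenrows_diag_inj detA; have injB := eigenrows_diag_inj detB.
have diagAB := same_norms_diag tA tB injB eqAB.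
have eqY j k : eigenrows A j k * (eigenrows A 0 k)^* =
               eigenrows B j k * (eigenrows B 0 k)^*.
  have := same_norms_columns tA tB eqAB (lagrange_num (fun i => A i i) j)
    (lagrange_num (fun i => A i i) 0) k.
  have eqL j' : lagrange_num (fun i => A i i) j' = lagrange_num (fun i => B i i) j'.
    by apply: eq_bigr => i _; rewrite diagAB.
  have row0 M (g : {poly C}) : upper_triangular M -> injective (fun i => M i i) ->
      \sum_i horner_mx M g i k *
        (horner_mx M (lagrange_num (fun i => M i i) 0) i k)^*
        = horner_mx M g 0 k * (eigenrows M 0 k)^*.
    move=> tM injM; rewrite (bigD1 0) //= big1 ?addr0 => [|i ne_i0].
      by rewrite [X in _ = _ * X^*]mxE.
    by rewrite (lagrange_num0_row tM injM) // rmorph0 mulr0.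
  rewrite (row0 A) // (eqL 0) (row0 B) //.
  by rewrite [eigenrows A j k]mxE [eigenrows B j k]mxE eqL.
pose u k := eigenrows B 0 k / eigenrows A 0 k.
(* [eqY] for [j = 0]: the first rows have entries of equal moduli. *)
have uuC k : u k * (u k)^* = 1.
  rewrite /u rmorphM /= fmorphV mulrACA -invfM eqY divff //.
  by rewrite mulf_neq0 ?conjC_eq0.
have YB j k : eigenrows B j k = eigenrows A j k * u k.
  have Y0BC : (eigenrows B 0 k)^* != 0 by rewrite conjC_eq0.
  apply: (mulIf Y0BC); rewrite -eqY -!mulrA; congr (_ * _).
  by apply: (mulfI (Y0A k)); rewrite eqY /u; field.
pose U : 'M[C]_n.+1 := diag_mx (\row_k u k).
have YBU : eigenrows B = eigenrows A *m U.
  by apply/matrixP => j k; rewrite mul_mx_diag YB [RHS]mxE [X in _ = _ * X]mxE.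
have U_unitary : U \is unitarymx.
  apply/unitarymxP/matrixP => i j; rewrite mul_diag_mx !mxE.
  case: eqVneq => [->|ne_ij]; first by rewrite !mulr1n uuC.
  by rewrite mulr0n rmorph0 mulr0.
exists U; first exact: U_unitary.
have UB : U *m B = A *m U.
  have YAu : eigenrows A \in unitmx by rewrite unitmxE unitfE; exact: detA.
  apply: (can_inj (mulKmx YAu)).
  rewrite mulmxA -YBU (eigenrows_mul tB) mulmxA (eigenrows_mul tA) -mulmxA -YBU.
  by congr (diag_mx _ *m _); apply/rowP => i; rewrite !mxE diagAB.
by rewrite -mulmxA -UB; apply: mulKmx; apply: unitarymx_unit U_unitary.
Qed.

End NormsToSimilarity.

(** * Unitary similarity implies equality of the norms *)

Section SimilarityToNorms.
Variable R : realType.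
Local Notation C := R[i].

Definition lexb (z w : C) : bool :=
  (complex.Re z < complex.Re w) ||
  (complex.Re z == complex.Re w) && (complex.Im z <= complex.Im w).

Lemma lexP z w : reflect (lexle z w) (lexb z w).
Proof.
apply: (iffP orP) => -[?|].
- by left.
- by case/andP => /eqP; right.
- by left.
- by case=> eq_re le_im; right; rewrite eq_re eqxx.
Qed.

Lemma lexb_trans : transitive lexb.
Proof.
move=> z w t /orP[lt_wz|/andP[/eqP eq_wz le_wz]] /orP[lt_zt|/andP[/eqP eq_zt le_zt]].
- by rewrite /lexb (lt_trans lt_wz).
- by rewrite /lexb -eq_zt lt_wz.
- by rewrite /lexb eq_wz lt_zt.
- by rewrite /lexb eq_wz eq_zt eqxx (le_trans le_wz) // orbT.
Qed.

Lemma lexb_anti : antisymmetric lexb.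
Proof.
move=> [a b] [c d] /andP[]; rewrite /lexb /= => /orP[lt_ac|/andP[/eqP-> le_bd]].
  case/orP => [/(lt_trans lt_ac)|/andP[/eqP eq_ca _]]; first by rewrite ltxx.
  by rewrite eq_ca ltxx in lt_ac.
by rewrite ltxx eqxx /= => le_db; congr Complex; apply/le_anti/andP.
Qed.

Variable n : nat.
Implicit Types (A B : 'M[C]_n.+1).

(** Both diagonals list the same simple spectrum in the same total order. *)
Lemma similar_diag A B (U : 'M[C]_n.+1) :
    upper_triangular A -> upper_triangular B ->
    injective (fun i => A i i) -> injective (fun i => B i i) ->
    lex_ordered_diag A -> lex_ordered_diag B ->
    U \in unitmx -> invmx U *m A *m U = B ->
  forall i, A i i = B i i.
Proof.
move=> tA tB injA injB lexA lexB Uu defB.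
pose d M := [seq M i i | i : 'I_n.+1] : seq C.
have rootE M z : upper_triangular M -> root (char_poly M) z = (z \in d M).
  move=> tM; rewrite char_poly_triu // -root_prod_XsubC.
  by rewrite big_image.
have uniq_d M : injective (fun i => M i i) -> uniq (d M).
  by move=> injM; rewrite map_inj_uniq ?enum_uniq.
have sorted_d M : lex_ordered_diag M -> sorted lexb (d M).
  move=> lexM; rewrite sorted_pairwise; last exact: lexb_trans.
  rewrite pairwise_map; apply: (@sub_pairwise _ (relpre val ltn)).
    by move=> i j lt_ij; apply/lexP/lexM/ltnW.
  rewrite -pairwise_map val_enum_ord -sorted_pairwise ?iota_ltn_sorted //.
  exact: ltn_trans.
have eq_d : d A = d B.
  apply: (sorted_eq lexb_trans lexb_anti); [exact: sorted_d | exact: sorted_d |].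
  apply: uniq_perm; [exact: uniq_d | exact: uniq_d |] => z.
  have eq_min : mxminpoly B = mxminpoly A.
    rewrite -defB -(conjVmx _ Uu); apply: mxminpoly_uconj.
    by rewrite unitmx_inv.
  rewrite -(rootE A z tA) -(rootE B z tB).
  by rewrite -(root_mxminpoly A) -(root_mxminpoly B) eq_min.
by move=> i; move/eq_in_map: eq_d; apply; rewrite mem_enum.
Qed.

(** The similarity is diagonal with unimodular entries, so it changes only the
    arguments of the entries of a polynomial in the matrix. *)
Lemma similar_same_norms A B : upper_triangular A -> upper_triangular B ->
    injective (fun i => A i i) -> injective (fun i => B i i) ->
    lex_ordered_diag A -> lex_ordered_diag B ->
  unitarily_similar A B -> same_norms A B.
Proof.
move=> tA tB injA injB lexA lexB [U U_unitary defB].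
have Uu := unitarymx_unit U_unitary.
have diagAB := similar_diag tA tB injA injB lexA lexB Uu defB.
have AU : A *m U = U *m B by rewrite -defB !mulmxA mulmxV // mul1mx.
have upper (M N V : 'M[C]_n.+1) : upper_triangular M -> upper_triangular N ->
    injective (fun i => M i i) -> (forall i, M i i = N i i) ->
    M *m V = V *m N -> forall i j : 'I_n.+1, (j < i)%N -> V i j = 0.
  move=> tM tN injM diagMN MV i j.
  apply: (@intertwiner_eq0 _ _ (fun i j : 'I_n.+1 => (j < i)%N) M N) => //.
  - by move=> i' j' k lt_ji /(ltn_trans lt_ji).
  - by move=> i' j' k lt_ji /ltn_trans; apply.
  - move=> i' j' lt_ji; rewrite -diagMN (inj_eq injM) -(inj_eq val_inj).
    by rewrite gtn_eqF.
have U_upper := upper A B U tA tB injA diagAB AU.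
(* The inverse intertwines [B] and [A], and is the conjugate transpose. *)
have U_lower (i j : 'I_n.+1) : (i < j)%N -> U i j = 0.
  have BV : B *m invmx U = invmx U *m A by rewrite -defB mulmxK.
  move/(upper B A (invmx U) tB tA injB (fsym diagAB) BV).
  rewrite invmx_unitary // !mxE => /eqP; rewrite conjC_eq0 => /eqP //.
pose u i := U i i.
have UE : U = diag_mx (\row_i u i).
  apply/matrixP => i j; rewrite !mxE; case: eqVneq => [->//|ne_ij].
  case: (ltngtP i j) => [/U_lower|/U_upper|/val_inj eq_ij] //.
  by rewrite eq_ij eqxx in ne_ij.
have norm_u i : `|u i| = 1.
  have /matrixP/(_ i i) := unitarymxP U_unitary.
  rewrite UE mul_diag_mx !mxE eqxx mulr1n -normCK => /eqP.
  by rewrite pexpr_eq1 ?normr_ge0 // => /eqP.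
move=> h k; congr sqrtC; apply: eq_bigr => i _; apply: eq_bigr => j _; congr (_ ^+ 2).
rewrite -!principal_horner // !mxE; set i' := widen_ord _ i; set j' := widen_ord _ j.
have /matrixP/(_ i' j') : U *m horner_mx B h = horner_mx A h *m U.
  by rewrite -defB horner_mx_uconjC // !mulmxA mulmxV // mul1mx.
rewrite UE mul_diag_mx mul_mx_diag !mxE => /(congr1 Num.norm).
by rewrite !normrM !norm_u mul1r mulr1.
Qed.

End SimilarityToNorms.

(** * The generic triangular matrix *)

Section GenericMatrix.
Variables (R : realType) (n : nat).

Lemma triu00 : (0, 0) \in triu n.+1.
Proof. by rewrite inE. Qed.

Definition triu_mx : 'M[triu_poly R n.+1]_n.+1 :=
  \matrix_(i, j) if (i <= j)%N then 'X_(enum_rank_in triu00 (i, j)) else 0.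

Lemma triu_mx_eval (A : 'M[R[i]]_n.+1) : upper_triangular A ->
  map_mx (meval (fun v => A (enum_val v).1 (enum_val v).2)) triu_mx = A.
Proof.
move=> tA; apply/matrixP => i j; rewrite !mxE.
case: leqP => [le_ij|lt_ji]; last by rewrite rmorph0 (upper_triangularP tA).
by rewrite mevalXU enum_rankK_in // inE.
Qed.

Lemma triu_eval_generic (A : 'M[R[i]]_n.+1) : upper_triangular A ->
  triu_eval (generic triu_mx) A = generic A.
Proof. by move=> tA; rewrite /triu_eval -map_generic triu_mx_eval. Qed.

End GenericMatrix.

(** * The criterion *)

Local Open Scope complex_scope.

Theorem theorem4 (R : realType) (n : nat) :
  exists f : triu_poly R n,
    f != 0 /\
    forall A B : 'M[R[i]]_n,
      in_Mn f A -> in_Mn f B ->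
      lex_ordered_diag A -> lex_ordered_diag B ->
      (unitarily_similar A B <->
       forall (h : {poly R[i]}) (k : 'I_n),
         frobenius (horner_mx (principal A k) h) =
         frobenius (horner_mx (principal B k) h)).
Proof.
case: n => [|n].
  exists 1; split=> [|A B _ _ _ _]; first exact: oner_neq0.
  split=> [_ h [] //|_]; exists 1%:M; last by apply/matrixP => -[].
  by apply/unitarymxP/matrixP => -[].
exists (generic (triu_mx R n)); split=> [|A B [tA fA] [tB fB] lexA lexB].
  have [A tA] := generic_witness R[i] n; apply: contra_neq => f0.
  by rewrite -triu_eval_generic // f0 /triu_eval rmorph0.
rewrite triu_eval_generic // in fA; rewrite triu_eval_generic // in fB.
split; last exact: same_norms_similar.
have [[detA _] [detB _]] := (genericP fA, genericP fB).
exact: similar_same_norms tA tB (eigenrows_diag_inj detA)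
  (eigenrows_diag_inj detB) lexA lexB.
Qed.
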